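(* Let $n$ be a positive integer and assume hypothesis $(\star)$ for $\mathbb{R}^n$: for every family $\mathcal{F}$ of closed Lebesgue-null subsets of $\mathbb{R}^n$ with $|\mathcal{F}|<\mathfrak{c}$ and every Lebesgue-null set $N\subset\mathbb{R}^n$, one has $N\cup\bigcup\mathcal{F}\neq\mathbb{R}^n$. (In particular this holds under the Continuum Hypothesis.) Then there exists a set $A\subset\mathbb{R}^n$ that is not Lebesgue null such that for every continuous function $f:\mathbb{R}^n\to\mathbb{R}$ the set $f(A)$ contains no non-degenerate interval.
   Context: $\mathfrak{c}$ denotes the cardinality of the continuum. *)

(* Defs.v *)
From Stdlib Require Import Reals Lra Lia Classical.
From Stdlib Require Fin.
Open Scope R_scope.

Definition Rn (n : nat) := Fin.t n -> R.

Fixpoint fprod (n : nat) : (Fin.t n -> R) -> R :=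
  match n with
  | O => fun _ => 1
  | S m => fun g => g Fin.F1 * fprod m (fun i => g (Fin.FS i))
  end.

Definition box_vol {n : nat} (a b : Rn n) : R := fprod n (fun i => b i - a i).

Definition in_box {n : nat} (a b x : Rn n) : Prop :=
  forall i, a i <= x i <= b i.

Definition lebesgue_null {n : nat} (N : Rn n -> Prop) : Prop :=
  forall eps : R, 0 < eps ->
    exists a b : nat -> Rn n,
      (forall k i, a k i <= b k i) /\
      (forall x, N x -> exists k, in_box (a k) (b k) x) /\
      (forall m, sum_f_R0 (fun k => box_vol (a k) (b k)) m <= eps).

(* closed subset of R^n (product / Euclidean topology, via sup-norm balls) *)
Definition closed_set {n : nat} (C : Rn n -> Prop) : Prop :=
  forall x, ~ C x -> exists r, 0 < r /\
    forall y, (forall i, Rabs (y i - x i) < r) -> ~ C y.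

Definition continuous_Rn {n : nat} (f : Rn n -> R) : Prop :=
  forall x eps, 0 < eps -> exists delta, 0 < delta /\
    forall y, (forall i, Rabs (y i - x i) < delta) -> Rabs (f y - f x) < eps.

Definition card_lt_continuum {T : Type} (F : T -> Prop) : Prop :=
  (exists g : {S : T | F S} -> R, forall u v, g u = g v -> u = v) /\
  ~ (exists h : R -> {S : T | F S}, forall x y, h x = h y -> x = y).

Definition star_hyp (n : nat) : Prop :=
  forall (F : (Rn n -> Prop) -> Prop) (N : Rn n -> Prop),
    (forall S, F S -> closed_set S /\ lebesgue_null S) ->
    card_lt_continuum F ->
    lebesgue_null N ->
    exists x : Rn n, ~ N x /\ forall S, F S -> ~ S x.

Definition image_contains_interval {n : nat} (f : Rn n -> R) (A : Rn n -> Prop) : Prop :=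
  exists a b : R, a < b /\ forall y, a <= y <= b -> exists x, A x /\ f x = y.

(* Main.v *)
Require Import Defs.
From Stdlib Require Import Reals Lra Lia List Cantor FinFun Wellfounded.
From Stdlib Require Import ClassicalEpsilon FunctionalExtensionality.
From Stdlib Require Fin.
From mathcomp Require eqtype boolp wochoice.
From Coquelicot Require Import Rcomplements Hierarchy Series.
From Coquelicot Require Compactness.
Open Scope R_scope.

(** The level sets of a continuous [f] are pairwise disjoint, so only countably
    many of them fail to be null. Well-order, with all proper segments of size
    less than the continuum, the triples (continuous [f], interval [[p, q]],
    null set from a cofinal family of continuum size). At stage [a] the hypothesis
    gives a point [x a] outside the [a]-th null set and outside the null level sets
    [f b = y b] chosen at the stages [b < a]; then fewer than continuum many values
    have to be avoided in order to choose [y a] in the [a]-th interval such that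
    the level set [f a = y a] is null and contains no [x b] with [b <= a]. The set
    of the points [x a] lies in no null set, and [f a] omits the value [y a] on it. *)

(** * Well-orders and transfinite choice *)

Definition trichotomous {T : Type} (lt : T -> T -> Prop) : Prop :=
  forall x y, lt x y \/ x = y \/ lt y x.

Lemma exists_well_order (T : Type) : exists lt : T -> T -> Prop,
  well_founded lt /\ trichotomous lt.
Proof.
  destruct (wochoice.well_ordering_principle
    (eqtype.Equality.Pack (eqtype.Equality.Class (boolp.gen_eqMixin T)))) as [le Hle].
  pose proof (wochoice.wo_chain_antisymmetric (@wochoice.withinW _ (fun _ => true) _ Hle)) as Hanti.
  pose (lt := fun x y => ~ le y x = true). exists lt. split.
  - intros x. apply NNPP. intros Hx.
    destruct (Hle (fun z => boolp.asbool (~ Acc lt z))) as [z [[Hz Hmin] _]].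
    { exists x. now apply boolp.asboolT. }
    apply (boolp.asboolW Hz). constructor. intros y Hyz. apply NNPP. intros Hy.
    apply Hyz, Hmin, boolp.asboolT, Hy.
  - intros x y. destruct (classic (le y x = true)) as [Hyx | Hyx]; [|now left].
    destruct (classic (le x y = true)) as [Hxy | Hxy]; [|now right; right].
    right. left. apply Hanti; try reflexivity. now rewrite Hxy, Hyx.
Qed.

(* If [T] injects into a segment of a well-order, pull the order back along an
   injection into the shortest such segment. *)
Lemma exists_initial_well_order (T : Type) : exists lt : T -> T -> Prop,
  well_founded lt /\ trichotomous lt /\
  forall x, ~ exists h : T -> T, Injective h /\ forall t, lt (h t) x.
Proof.
  destruct (exists_well_order T) as [lt [Hwf Htri]].
  destruct (classic (exists x, exists h : T -> T, Injective h /\ forall t, lt (h t) x))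
    as [[x Hx] | Hno].
  - revert Hx. induction x as [x IH] using (well_founded_ind Hwf). intros [h [Hh Hlt]].
    destruct (classic (exists y, lt y x /\ exists h : T -> T, Injective h /\ forall t, lt (h t) y))
      as [[y [Hy Hex]] | Hmin]; [exact (IH y Hy Hex)|].
    exists (fun a b => lt (h a) (h b)). split; [|split].
    + exact (wf_inverse_image _ _ lt h Hwf).
    + intros a b. destruct (Htri (h a) (h b)) as [? | [E | ?]]; auto.
    + intros y [h' [Hh' Hlt']]. apply Hmin. exists (h y). split; [apply Hlt|].
      exists (fun t => h (h' t)). split; [|exact Hlt'].
      intros a b E. apply Hh', Hh, E.
  - exists lt. split; [exact Hwf | split; [exact Htri|]].
    intros x Hx. apply Hno. now exists x.
Qed.

Lemma transfinite_choice {T X : Type} (lt : T -> T -> Prop) (P : T -> (T -> X) -> X -> Prop) :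
  well_founded lt -> inhabited X ->
  (forall a g g' x, (forall b, lt b a -> g b = g' b) -> P a g x -> P a g' x) ->
  (forall a g, (forall b, lt b a -> P b g (g b)) -> exists x, P a g x) ->
  exists g, forall a, P a g (g a).
Proof.
  intros Hwf HX Hext Hex.
  pose (extend := fun a (g : forall b, lt b a -> X) b =>
    match excluded_middle_informative (lt b a) with
    | left Hb => g b Hb
    | right _ => epsilon HX (fun _ => True)
    end).
  pose (step := fun a (g : forall b, lt b a -> X) => epsilon HX (P a (extend a g))).
  pose (g := Fix Hwf (fun _ => X) step).
  assert (Hg : forall a, g a = epsilon HX (P a (extend a (fun b _ => g b)))).
  { intros a. unfold g at 1. rewrite Fix_eq; [reflexivity|].
    intros b h h' E. f_equal. extensionality c. extensionality Hc. apply E. }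
  assert (Hextend : forall a b, lt b a -> extend a (fun b _ => g b) b = g b).
  { intros a b Hb. unfold extend. now destruct (excluded_middle_informative (lt b a)). }
  exists g. intros a. induction a as [a IH] using (well_founded_ind Hwf).
  apply Hext with (1 := Hextend a). rewrite Hg. apply epsilon_spec.
  destruct (Hex a g IH) as [x Hx]. exists x. apply Hext with (2 := Hx).
  intros b Hb. now rewrite Hextend.
Qed.

(* Only the [y a] chosen before [x b] constrain [x b]: each later [y a] is chosen
   off [f a (x b)]. *)
Lemma transfinite_avoidance {T X Y : Type} (lt : T -> T -> Prop)
    (f : T -> X -> Y) (forbidden : T -> X -> Prop) (admissible : T -> Y -> Prop) :
  well_founded lt -> trichotomous lt -> inhabited X -> inhabited Y ->
  (forall a (y : T -> Y), (forall b, lt b a -> admissible b (y b)) ->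
    exists x, ~ forbidden a x /\ forall b, lt b a -> f b x <> y b) ->
  (forall a (x : T -> X) xa, exists y,
    admissible a y /\ f a xa <> y /\ forall b, lt b a -> f a (x b) <> y) ->
  exists (x : T -> X) (y : T -> Y), forall a,
    ~ forbidden a (x a) /\ admissible a (y a) /\ forall b, f a (x b) <> y a.
Proof.
  intros Hwf Htri [x0] [y0] Hpoint Hvalue.
  destruct (transfinite_choice lt (fun a (g : T -> X * Y) xy =>
    (~ forbidden a (fst xy) /\ forall b, lt b a -> f b (fst xy) <> snd (g b)) /\
    admissible a (snd xy) /\ f a (fst xy) <> snd xy /\
    forall b, lt b a -> f a (fst (g b)) <> snd xy)) as [g Hg].
  - exact Hwf.
  - exact (inhabits (x0, y0)).
  - intros a g g' xy E [[Hforb Hpast] [Hadm [Hdiag Hbelow]]].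
    repeat split; try assumption; intros b Hb; rewrite <- E by exact Hb; auto.
  - intros a g IH.
    destruct (Hpoint a (fun b => snd (g b))) as [x Hx]; [intros b Hb; apply (IH b Hb)|].
    destruct (Hvalue a (fun b => fst (g b)) x) as [y Hy].
    now exists (x, y).
  - exists (fun a => fst (g a)), (fun a => snd (g a)). intros a.
    destruct (Hg a) as [[Hforb _] [Hadm [Hdiag Hbelow]]].
    split; [exact Hforb | split; [exact Hadm|]]. intros b.
    destruct (Htri b a) as [Hb | [-> | Hb]]; [now apply Hbelow | exact Hdiag|].
    destruct (Hg b) as [[_ Hpast] _]. now apply Hpast.
Qed.

(** * Cardinality at most, and less than, the continuum *)

Definition le_continuum (X : Type) : Prop := exists h : X -> R, Injective h.

(* Cardinals being comparable, this says that [P] has fewer than continuum many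
   elements. *)
Definition lt_continuum {X : Type} (P : X -> Prop) : Prop :=
  ~ exists h : R -> X, Injective h /\ forall t, P (h t).

Definition countable {X : Type} (P : X -> Prop) : Prop :=
  exists e : nat -> option X, forall x, P x -> exists k, e k = Some x.

Definition cantor_term (b : nat -> bool) (k : nat) : R := (if b k then 1 else -1) * (/ 3) ^ k.

Definition cantor_value (b : nat -> bool) : R := Series (cantor_term b).

Lemma Rabs_cantor_term b k : Rabs (cantor_term b k) = (/ 3) ^ k.
Proof.
  unfold cantor_term. rewrite Rabs_mult, (Rabs_pos_eq ((/ 3) ^ k)) by (apply pow_le; lra).
  destruct (b k); [rewrite Rabs_R1 | rewrite Rabs_left1 by lra]; ring.
Qed.

Lemma ex_series_Rabs_cantor_term b : ex_series (fun k => Rabs (cantor_term b k)).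
Proof.
  rewrite (functional_extensionality _ _ (Rabs_cantor_term b)).
  apply ex_series_geom. rewrite Rabs_pos_eq; lra.
Qed.

Lemma cantor_value_bound b : - (3 / 2) <= cantor_value b <= 3 / 2.
Proof.
  apply Rabs_le_between.
  apply Rle_trans with (1 := Series_Rabs _ (ex_series_Rabs_cantor_term b)).
  rewrite (Series_ext _ _ (Rabs_cantor_term b)), Series_geom; [lra|].
  rewrite Rabs_pos_eq; lra.
Qed.

Lemma cantor_value_shift b :
  cantor_value b = (if b 0%nat then 1 else -1) + / 3 * cantor_value (fun k => b (S k)).
Proof.
  unfold cantor_value at 1.
  rewrite Series_incr_1 by apply ex_series_Rabs, ex_series_Rabs_cantor_term.
  unfold cantor_value. rewrite <- Series_scal_l. f_equal; [unfold cantor_term; simpl; ring|].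
  apply Series_ext. intros k. unfold cantor_term. simpl. ring.
Qed.

Lemma cantor_value_injective : Injective cantor_value.
Proof.
  intros b b' E. extensionality m. revert b b' E. induction m as [|m IH]; intros b b' E.
  all: pose proof (cantor_value_bound (fun k => b (S k))).
  all: pose proof (cantor_value_bound (fun k => b' (S k))).
  all: rewrite (cantor_value_shift b), (cantor_value_shift b') in E.
  - destruct (b 0%nat), (b' 0%nat); try reflexivity; lra.
  - apply (IH (fun k => b (S k)) (fun k => b' (S k))). destruct (b 0%nat), (b' 0%nat); lra.
Qed.

Definition rat (k : nat) : R :=
  let (p, m) := of_nat k in let (i, j) := of_nat p in (INR i - INR j) / INR m.

Lemma exists_rat_between x y : x < y -> exists k, x < rat k < y.
Proof.
  intros Hxy. destruct (archimed_cor1 (y - x)) as [m [Hm Hpos]]; [lra|].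
  apply lt_0_INR in Hpos. destruct (archimed (x * INR m)) as [Hz Hz'].
  set (z := up (x * INR m)) in *.
  exists (to_nat (to_nat (Z.to_nat z, Z.to_nat (- z)), m)).
  unfold rat. rewrite !cancel_of_to.
  replace (INR (Z.to_nat z) - INR (Z.to_nat (- z))) with (IZR z)
    by (rewrite !INR_IZR_INZ, <- minus_IZR; f_equal; lia).
  split; [now apply Rlt_div_r|]. apply Rlt_div_l; [exact Hpos|].
  apply (Rmult_lt_compat_r _ _ _ Hpos) in Hm. rewrite Rinv_l in Hm; lra.
Qed.

Definition rat_cut (x : R) (k : nat) : bool := if Rlt_dec (rat k) x then true else false.

Lemma rat_cut_injective : Injective rat_cut.
Proof.
  assert (Hneq : forall x y, x < y -> rat_cut x <> rat_cut y).
  { intros x y Hxy E. destruct (exists_rat_between x y Hxy) as [k Hk].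
    apply (f_equal (fun b => b k)) in E. unfold rat_cut in E.
    destruct (Rlt_dec (rat k) x), (Rlt_dec (rat k) y); try discriminate; lra. }
  intros x y E. destruct (Rtotal_order x y) as [Hlt | [Heq | Hgt]]; [|exact Heq|].
  - now destruct (Hneq x y Hlt).
  - now destruct (Hneq y x Hgt).
Qed.

Lemma le_continuum_R : le_continuum R.
Proof. now exists (fun x => x). Qed.

Lemma le_continuum_seq_R : le_continuum (nat -> R).
Proof.
  exists (fun u => cantor_value (fun k => let (i, j) := of_nat k in rat_cut (u i) j)).
  intros u v E. apply cantor_value_injective in E.
  extensionality i. apply rat_cut_injective. extensionality j.
  apply (f_equal (fun b => b (to_nat (i, j)))) in E. now rewrite cancel_of_to in E.
Qed.

Lemma le_continuum_inj {X Y : Type} (g : X -> Y) : Injective g -> le_continuum Y -> le_continuum X.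
Proof. intros Hg [h Hh]. exists (fun x => h (g x)). intros x x' E. apply Hg, Hh, E. Qed.

Lemma le_continuum_seq (X : Type) : le_continuum X -> le_continuum (nat -> X).
Proof.
  intros [h Hh]. apply (le_continuum_inj (fun u k => h (u k))); [|exact le_continuum_seq_R].
  intros u v E. extensionality k. apply Hh. exact (f_equal (fun w => w k) E).
Qed.

Lemma le_continuum_prod (X Y : Type) : le_continuum X -> le_continuum Y -> le_continuum (X * Y).
Proof.
  intros [h Hh] [h' Hh'].
  apply (le_continuum_inj (fun p k => match k with O => h (fst p) | S _ => h' (snd p) end)).
  - intros [x y] [x' y'] E.
    pose proof (f_equal (fun u => u 0%nat) E) as Ex.
    pose proof (f_equal (fun u => u 1%nat) E) as Ey.
    apply Hh in Ex. apply Hh' in Ey. simpl in Ex, Ey. now subst.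
  - exact le_continuum_seq_R.
Qed.

(* Identify [R] with [R * R]: if every column contains a point of [P], a choice of
   such points is a copy of [R] inside [P]; otherwise some column lies in [Q]. *)
Lemma lt_continuum_union {X : Type} (P Q : X -> Prop) :
  lt_continuum P -> lt_continuum Q -> lt_continuum (fun x => P x \/ Q x).
Proof.
  intros HP HQ [h [Hh HPQ]].
  destruct (le_continuum_prod R R le_continuum_R le_continuum_R) as [pair Hpair].
  destruct (classic (forall r, exists s, P (h (pair (r, s))))) as [Hcol | Hcol].
  - destruct (choice _ Hcol) as [s Hs]. apply HP.
    exists (fun r => h (pair (r, s r))). split; [|exact Hs].
    intros r r' E. apply Hh, Hpair in E. congruence.
  - apply not_all_ex_not in Hcol. destruct Hcol as [r Hr]. apply HQ.
    exists (fun s => h (pair (r, s))). split.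
    + intros s s' E. apply Hh, Hpair in E. congruence.
    + intros s. destruct (HPQ (pair (r, s))) as [HPs | HQs]; [|exact HQs].
      destruct Hr. now exists s.
Qed.

Lemma lt_continuum_image {X Y : Type} (g : X -> Y) (P : X -> Prop) :
  lt_continuum P -> lt_continuum (fun y => exists x, P x /\ y = g x).
Proof.
  intros HP [h [Hh Himg]]. destruct (choice _ Himg) as [k Hk]. apply HP.
  exists k. split; [|apply Hk]. intros t t' E. apply Hh.
  now rewrite (proj2 (Hk t)), (proj2 (Hk t')), E.
Qed.

(* Cantor's diagonal argument against an enumeration of the values
   [h (cantor_value b)]. *)
Lemma lt_continuum_countable {X : Type} (P : X -> Prop) : countable P -> lt_continuum P.
Proof.
  intros [e He] [h [Hh HP]].
  pose (listed := fun k => exists b, e k = Some (h (cantor_value b)) /\ b k = true).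
  pose (diag := fun k => boolp.asbool (~ listed k)).
  destruct (He (h (cantor_value diag)) (HP _)) as [k Hk].
  assert (Hnot : ~ listed k).
  { intros Hlisted. assert (Hb := Hlisted). destruct Hb as [b [Eb Hb]].
    rewrite Hk in Eb. injection Eb as Eb. apply Hh, cantor_value_injective in Eb. subst b.
    exact (boolp.asboolW Hb Hlisted). }
  apply Hnot. exists diag. split; [exact Hk | now apply boolp.asboolT].
Qed.

Lemma not_lt_continuum_interval p q : p < q -> ~ lt_continuum (fun y => p <= y <= q).
Proof.
  intros Hpq Hlt. apply Hlt.
  exists (fun t => p + (q - p) * (atan t / PI + / 2)). pose proof PI_RGT_0 as Hpi. split.
  - intros s t E. apply Rplus_eq_reg_l, Rmult_eq_reg_l, Rplus_eq_reg_r in E; [|lra].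
    apply Rmult_eq_reg_r in E; [|apply Rinv_neq_0_compat; lra].
    now rewrite <- (tan_atan s), <- (tan_atan t), E.
  - intros t. destruct (atan_bound t) as [Hlo Hhi].
    assert (- / 2 <= atan t / PI <= / 2).
    { split; [apply Rle_div_r | apply Rle_div_l]; lra. }
    split; nra.
Qed.

Lemma countable_subset {X : Type} (P Q : X -> Prop) :
  (forall x, P x -> Q x) -> countable Q -> countable P.
Proof. intros HPQ [e He]. exists e. auto. Qed.

Lemma countable_of_list {X : Type} (P : X -> Prop) (l : list X) :
  (forall x, P x -> In x l) -> countable P.
Proof. intros Hl. exists (nth_error l). intros x Hx. apply In_nth_error, Hl, Hx. Qed.

Lemma countable_bigcup {X : Type} (P : nat -> X -> Prop) :
  (forall i, countable (P i)) -> countable (fun x => exists i, P i x).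
Proof.
  intros HP. destruct (choice _ HP) as [e He].
  exists (fun k => let (i, j) := of_nat k in e i j). intros x [i Hx].
  destruct (He i x Hx) as [j Hj]. exists (to_nat (i, j)). now rewrite cancel_of_to.
Qed.

Lemma card_lt_continuum_image {X Y : Type} (g : X -> Y) (P : X -> Prop) :
  le_continuum X -> lt_continuum P -> card_lt_continuum (fun y => exists x, P x /\ y = g x).
Proof.
  intros [h Hh] HP. split.
  - destruct (choice (fun (u : {y | exists x, P x /\ y = g x}) x => proj1_sig u = g x)) as [k Hk].
    { intros [y Hy]. simpl. destruct Hy as [x [_ E]]. now exists x. }
    exists (fun u => h (k u)). intros u v E. apply Hh in E.
    apply eq_sig_hprop; [intros; apply proof_irrelevance|]. now rewrite !Hk, E.
  - intros [c Hc]. apply (lt_continuum_image g P HP).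
    exists (fun t => proj1_sig (c t)). split; [|intros t; exact (proj2_sig (c t))].
    intros s t E. apply Hc, eq_sig_hprop; [intros; apply proof_irrelevance | exact E].
Qed.

Lemma exists_continuum_well_order (T : Type) : le_continuum T ->
  exists lt : T -> T -> Prop,
    well_founded lt /\ trichotomous lt /\ forall a, lt_continuum (fun b => lt b a).
Proof.
  intros [c Hc]. destruct (exists_initial_well_order T) as [lt [Hwf [Htri Hinit]]].
  exists lt. split; [exact Hwf | split; [exact Htri|]].
  intros a [h [Hh Hlt]]. apply (Hinit a). exists (fun t => h (c t)). split; [|auto].
  intros s t E. apply Hc, Hh, E.
Qed.

(** * Points and continuous functions of [Rn n] *)

Definition vcons {n} (x : R) (v : Rn n) : Rn (S n) :=
  fun i => Fin.caseS' i (fun _ => R) x v.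

Definition vtail {n} (v : Rn (S n)) : Rn n := fun i => v (Fin.FS i).

Lemma le_continuum_Rn n : le_continuum (Rn n).
Proof.
  induction n as [|n IH].
  - exists (fun _ => 0). intros x y _. extensionality i. now apply Fin.case0.
  - apply (le_continuum_inj (fun x : Rn (S n) => (x Fin.F1, vtail x))).
    + intros x y E. injection E as Ehd Etl. extensionality i.
      apply (Fin.caseS' i); [exact Ehd|]. intros j. exact (f_equal (fun v => v j) Etl).
    + apply le_continuum_prod; [exact le_continuum_R | exact IH].
Qed.

Fixpoint rat_point (n : nat) (k : nat) : Rn n :=
  match n with
  | O => fun _ => 0
  | S m => let (i, j) := of_nat k in vcons (rat i) (rat_point m j)
  end.

Lemma exists_rat_point_near {n} (x : Rn n) d : 0 < d ->
  exists k, forall i, Rabs (rat_point n k i - x i) < d.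
Proof.
  intros Hd. induction n as [|n IH].
  - exists 0%nat. intros i. now apply Fin.case0.
  - destruct (IH (vtail x)) as [k Hk].
    destruct (exists_rat_between (x Fin.F1 - d) (x Fin.F1 + d)) as [j Hj]; [lra|].
    exists (to_nat (j, k)). cbn [rat_point]. rewrite cancel_of_to. intros i.
    apply (Fin.caseS' i); [apply Rabs_def1; simpl; lra | exact Hk].
Qed.

Lemma continuous_Rn_const n (c : R) : continuous_Rn (fun _ : Rn n => c).
Proof.
  intros x eps Heps. exists 1. split; [lra|]. intros y _. now rewrite Rminus_diag, Rabs_R0.
Qed.

Lemma continuous_Rn_ext_rat_point {n} (f g : Rn n -> R) : continuous_Rn f -> continuous_Rn g ->
  (forall k, f (rat_point n k) = g (rat_point n k)) -> f = g.
Proof.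
  intros Hf Hg E. extensionality x. apply Rminus_diag_uniq, NNPP. intros Hne.
  assert (He : 0 < Rabs (f x - g x) / 2) by (apply Rabs_pos_lt in Hne; lra).
  destruct (Hf x _ He) as [df [Hdf Hf']], (Hg x _ He) as [dg [Hdg Hg']].
  destruct (exists_rat_point_near x (Rmin df dg)) as [k Hk]; [now apply Rmin_pos|].
  pose proof (Hf' _ (fun i => Rlt_le_trans _ _ _ (Hk i) (Rmin_l df dg))) as Hfk.
  pose proof (Hg' _ (fun i => Rlt_le_trans _ _ _ (Hk i) (Rmin_r df dg))) as Hgk.
  rewrite E, Rabs_minus_sym in Hfk.
  pose proof (Rdist_tri (f x) (g x) (g (rat_point n k))) as Htri.
  unfold Rdist in Htri. lra.
Qed.

Lemma le_continuum_continuous n : le_continuum {f : Rn n -> R | continuous_Rn f}.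
Proof.
  apply (le_continuum_inj (fun f k => proj1_sig f (rat_point n k))).
  - intros [f Hf] [g Hg] E. apply eq_sig_hprop; [intros; apply proof_irrelevance|].
    apply continuous_Rn_ext_rat_point; [exact Hf | exact Hg|].
    intros k. exact (f_equal (fun u => u k) E).
  - exact le_continuum_seq_R.
Qed.

Fixpoint to_Tn (n : nat) : Rn n -> Compactness.Tn n R :=
  match n with
  | O => fun _ => tt
  | S m => fun x => (x Fin.F1, to_Tn m (vtail x))
  end.

Fixpoint of_Tn (n : nat) : Compactness.Tn n R -> Rn n :=
  match n with
  | O => fun _ _ => 0
  | S m => fun t => vcons (fst t) (of_Tn m (snd t))
  end.

Lemma bounded_n_to_Tn {n} (a b x : Rn n) :
  in_box a b x -> Compactness.bounded_n n (to_Tn n a) (to_Tn n b) (to_Tn n x).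
Proof.
  induction n as [|n IH]; intros Hx; simpl; [exact I|].
  split; [apply Hx|]. apply IH. intros i. apply Hx.
Qed.

Lemma close_n_to_Tn {n} d (x : Rn n) t :
  Compactness.close_n n d (to_Tn n x) t -> forall i, Rabs (x i - of_Tn n t i) < d.
Proof.
  induction n as [|n IH]; intros Hxt i; [now apply Fin.case0|].
  destruct t as [t1 t2], Hxt as [Hhd Htl].
  apply (Fin.caseS' i); [exact Hhd|]. exact (IH _ _ Htl).
Qed.

Lemma continuous_Rn_uniform_on_box {n} (f : Rn n -> R) (a b : Rn n) eps :
  continuous_Rn f -> 0 < eps ->
  exists d, 0 < d /\ forall x y, in_box a b x -> (forall i, Rabs (y i - x i) < d) ->
    Rabs (f y - f x) < eps.
Proof.
  intros Hf Heps.
  destruct (choice (fun (x : Rn n) (d : posreal) =>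
    forall y, (forall i, Rabs (y i - x i) < 2 * d) -> Rabs (f y - f x) < eps / 2)) as [D HD].
  { intros x. destruct (Hf x (eps / 2)) as [d [Hd Hfx]]; [lra|].
    assert (Hd2 : 0 < d / 2) by lra.
    exists (mkposreal _ Hd2). simpl. intros y Hy. apply Hfx. intros i. specialize (Hy i). lra. }
  destruct (Compactness.compactness_value n (to_Tn n a) (to_Tn n b) (fun t => D (of_Tn n t)))
    as [d Hd].
  exists d. split; [apply cond_pos|]. intros x y Hx Hxy.
  apply NNPP. intros Hno. apply (Hd (to_Tn n x) (bounded_n_to_Tn a b x Hx)).
  intros [t [_ [Hxt Hdt]]]. apply Hno. pose proof (close_n_to_Tn _ _ _ Hxt) as Hxc.
  set (c := of_Tn n t) in *. pose proof (cond_pos (D c)).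
  assert (Hfx : Rabs (f x - f c) < eps / 2).
  { apply HD. intros i. specialize (Hxc i). lra. }
  assert (Hfy : Rabs (f y - f c) < eps / 2).
  { apply HD. intros i. specialize (Hxc i). specialize (Hxy i).
    pose proof (Rdist_tri (y i) (c i) (x i)) as Htri. unfold Rdist in Htri. lra. }
  pose proof (Rdist_tri (f y) (f x) (f c)) as Htri. unfold Rdist in Htri.
  rewrite (Rabs_minus_sym (f c)) in Htri. lra.
Qed.

(** * Sums over lists *)

Definition sumR {A : Type} (w : A -> R) (l : list A) : R := fold_right Rplus 0 (map w l).

Lemma sumR_cons {A} (w : A -> R) a l : sumR w (a :: l) = w a + sumR w l.
Proof. reflexivity. Qed.

Lemma sumR_map {A B} (w : B -> R) (g : A -> B) l : sumR w (map g l) = sumR (fun a => w (g a)) l.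
Proof. unfold sumR. now rewrite map_map. Qed.

Lemma sumR_app {A} (w : A -> R) l l' : sumR w (l ++ l') = sumR w l + sumR w l'.
Proof.
  induction l as [|a l IH]; [unfold sumR; simpl; ring|].
  simpl app. rewrite !sumR_cons, IH. ring.
Qed.

Lemma sumR_scal {A} (w : A -> R) c l : sumR (fun a => c * w a) l = c * sumR w l.
Proof.
  induction l as [|a l IH]; [unfold sumR; simpl; ring|]. rewrite !sumR_cons, IH. ring.
Qed.

Lemma sumR_list_prod {A B} (w : A * B -> R) l l' :
  sumR w (list_prod l l') = sumR (fun a => sumR (fun b => w (a, b)) l') l.
Proof.
  induction l as [|a l IH]; [reflexivity|].
  simpl list_prod. now rewrite sumR_app, sumR_map, sumR_cons, IH.
Qed.

Lemma sumR_filter_split {A} (w : A -> R) (p : A -> bool) l :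
  sumR w l = sumR w (filter p l) + sumR w (filter (fun a => negb (p a)) l).
Proof.
  induction l as [|a l IH]; [unfold sumR; simpl; ring|].
  simpl filter. destruct (p a); simpl negb; cbn iota; rewrite !sumR_cons, IH; ring.
Qed.

Lemma sumR_le {A} (w w' : A -> R) l :
  (forall a, In a l -> w a <= w' a) -> sumR w l <= sumR w' l.
Proof.
  induction l as [|a l IH]; intros Hle; [apply Rle_refl|].
  rewrite !sumR_cons. apply Rplus_le_compat; [apply Hle; now left|].
  apply IH. intros b Hb. apply Hle. now right.
Qed.

Lemma sumR_0 {A} (l : list A) : sumR (fun _ => 0) l = 0.
Proof. induction l as [|a l IH]; [reflexivity|]. rewrite sumR_cons, IH. ring. Qed.

Lemma sumR_nonneg {A} (w : A -> R) l : (forall a, In a l -> 0 <= w a) -> 0 <= sumR w l.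
Proof.
  intros Hw. rewrite <- (sumR_0 l). now apply sumR_le.
Qed.

Lemma sumR_incl {A} (w : A -> R) l l' :
  (forall a, 0 <= w a) -> NoDup l -> incl l l' -> sumR w l <= sumR w l'.
Proof.
  intros Hw Hnd. revert l'. induction Hnd as [|a l Ha Hnd IH]; intros l' Hincl.
  - now apply sumR_nonneg.
  - destruct (in_split a l') as [l1 [l2 ->]]; [apply Hincl; now left|].
    rewrite sumR_app, !sumR_cons.
    enough (sumR w l <= sumR w (l1 ++ l2)) as Hle by (rewrite sumR_app in Hle; lra).
    apply IH. intros b Hb. apply in_or_app.
    destruct (in_app_or _ _ _ (Hincl b (or_intror Hb))) as [? | [-> | ?]]; auto.
    contradiction.
Qed.

Lemma sum_f_R0_sumR (w : nat -> R) m : sum_f_R0 w m = sumR w (seq 0 (S m)).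
Proof.
  induction m as [|m IH]; [unfold sumR; simpl; ring|].
  rewrite seq_S, sumR_app, <- IH. unfold sumR. simpl. ring.
Qed.

Lemma sumR_half_pow_le m : sumR (fun i => (/ 2) ^ (S i)) (seq 0 m) <= 1.
Proof.
  enough (sumR (fun i => (/ 2) ^ (S i)) (seq 0 m) = 1 - (/ 2) ^ m) as ->.
  { pose proof (pow_lt (/ 2) m). lra. }
  induction m as [|m IH]; [unfold sumR; simpl; ring|].
  rewrite seq_S, sumR_app, IH. unfold sumR. simpl. field.
Qed.

Lemma sumR_nth_le {A} (w : A -> R) d l m : w d = 0 -> (forall a, In a l -> 0 <= w a) ->
  sumR (fun k => w (nth k l d)) (seq 0 m) <= sumR w l.
Proof.
  intros Hd. revert m. induction l as [|a l IH]; intros m Hw.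
  - unfold sumR at 2. simpl. rewrite <- (sumR_0 (seq 0 m)).
    apply sumR_le. intros [|k] _; simpl; lra.
  - destruct m as [|m]; [now apply sumR_nonneg|].
    simpl seq. rewrite <- seq_shift, !sumR_cons, sumR_map.
    apply Rplus_le_compat_l, IH. intros b Hb. apply Hw. now right.
Qed.

(** * Null sets and covers by boxes *)

Definition box (n : nat) : Type := Rn n * Rn n.

Definition mem_box {n} (c : box n) (x : Rn n) : Prop := in_box (fst c) (snd c) x.

Definition proper_box {n} (c : box n) : Prop := forall i, fst c i <= snd c i.

Definition vol {n} (c : box n) : R := box_vol (fst c) (snd c).

Definition box_cons {n} (J : R * R) (c : box n) : box (S n) :=
  (vcons (fst J) (fst c), vcons (snd J) (snd c)).

Lemma fprod_nonneg {n} (g : Fin.t n -> R) : (forall i, 0 <= g i) -> 0 <= fprod n g.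
Proof.
  induction n as [|n IH]; intros Hg; simpl; [lra|].
  apply Rmult_le_pos; [apply Hg|]. apply IH. intros i. apply Hg.
Qed.

Lemma vol_nonneg {n} (c : box n) : proper_box c -> 0 <= vol c.
Proof. intros Hc. apply fprod_nonneg. intros i. specialize (Hc i). lra. Qed.

Lemma vol_point {n} (x : Rn n) : (0 < n)%nat -> vol (x, x) = 0.
Proof. intros Hn. destruct n as [|n]; [lia|]. unfold vol, box_vol. simpl. ring. Qed.

Definition box_cover {n} (A : Rn n -> Prop) (eps : R) (c : nat -> box n) : Prop :=
  (forall k, proper_box (c k)) /\
  (forall x, A x -> exists k, mem_box (c k) x) /\
  (forall m, sumR (fun k => vol (c k)) (seq 0 m) <= eps).

Definition outer_measure_le {n} (A : Rn n -> Prop) (eps : R) : Prop :=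
  exists c, box_cover A eps c.

Lemma outer_measure_le_mono {n} (A A' : Rn n -> Prop) eps eps' :
  (forall x, A x -> A' x) -> eps' <= eps -> outer_measure_le A' eps' -> outer_measure_le A eps.
Proof.
  intros HA Heps [c [Hc [Hcover Hsum]]]. exists c. split; [exact Hc | split].
  - auto.
  - intros m. now apply Rle_trans with (1 := Hsum m).
Qed.

Lemma lebesgue_null_iff_outer_measure_le {n} (A : Rn n -> Prop) :
  lebesgue_null A <-> forall eps, 0 < eps -> outer_measure_le A eps.
Proof.
  split; intros HA eps Heps.
  - destruct (HA eps Heps) as [a [b [Hab [Hcover Hsum]]]].
    exists (fun k => (a k, b k)). split; [exact Hab | split; [exact Hcover|]].
    intros [|m]; [unfold sumR; simpl; lra|]. rewrite <- sum_f_R0_sumR. apply Hsum.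
  - destruct (HA eps Heps) as [c [Hc [Hcover Hsum]]].
    exists (fun k => fst (c k)), (fun k => snd (c k)). split; [exact Hc | split; [exact Hcover|]].
    intros m. rewrite sum_f_R0_sumR. apply Hsum.
Qed.

Lemma lebesgue_null_of_outer_measure_le_inv {n} (A : Rn n -> Prop) :
  (forall j, outer_measure_le A (/ INR (S j))) -> lebesgue_null A.
Proof.
  intros HA. apply lebesgue_null_iff_outer_measure_le. intros eps Heps.
  destruct (archimed_cor1 eps Heps) as [[|j] [Hj Hpos]]; [lia|].
  apply outer_measure_le_mono with (3 := HA j); [auto | lra].
Qed.

Lemma lebesgue_null_subset {n} (A A' : Rn n -> Prop) :
  (forall x, A x -> A' x) -> lebesgue_null A' -> lebesgue_null A.
Proof.
  rewrite !lebesgue_null_iff_outer_measure_le. intros HA HA' eps Heps.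
  apply outer_measure_le_mono with (1 := HA) (3 := HA' eps Heps). apply Rle_refl.
Qed.

Lemma lebesgue_null_bigcup {n} (A : nat -> Rn n -> Prop) :
  (forall i, lebesgue_null (A i)) -> lebesgue_null (fun x => exists i, A i x).
Proof.
  intros HA. apply lebesgue_null_iff_outer_measure_le. intros eps Heps.
  destruct (choice (fun i => box_cover (A i) (eps * (/ 2) ^ (S i)))) as [c Hc].
  { intros i. apply (proj1 (lebesgue_null_iff_outer_measure_le (A i)) (HA i)).
    apply Rmult_lt_0_compat; [exact Heps | apply pow_lt; lra]. }
  pose (c2 := fun p => c (fst p) (snd p)).
  exists (fun k => c2 (of_nat k)). split; [|split].
  - intros k. apply Hc.
  - intros x [i Hx]. destruct (proj1 (proj2 (Hc i)) x Hx) as [j Hj].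
    exists (to_nat (i, j)). now rewrite cancel_of_to.
  - intros m. rewrite <- (sumR_map (fun p => vol (c2 p)) of_nat).
    apply Rle_trans with (sumR (fun p => vol (c2 p)) (list_prod (seq 0 m) (seq 0 m))).
    + apply sumR_incl.
      * intros p. apply vol_nonneg, Hc.
      * apply Injective_map_NoDup; [exact of_nat_inj | apply seq_NoDup].
      * intros [i j] Hij. apply in_map_iff in Hij. destruct Hij as [k [Hk Hkm]].
        apply in_seq in Hkm. apply (f_equal to_nat) in Hk. rewrite cancel_to_of in Hk.
        pose proof (to_nat_non_decreasing i j).
        apply in_prod; apply in_seq; lia.
    + rewrite sumR_list_prod.
      apply Rle_trans with (sumR (fun i => eps * (/ 2) ^ (S i)) (seq 0 m)).
      * apply sumR_le. intros i _. exact (proj2 (proj2 (Hc i)) m).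
      * rewrite sumR_scal. pose proof (sumR_half_pow_le m). nra.
Qed.

Lemma outer_measure_le_list {n} (A : Rn n -> Prop) eps (l : list (box n)) : (0 < n)%nat ->
  (forall c, In c l -> proper_box c) ->
  (forall x, A x -> exists c, In c l /\ mem_box c x) ->
  sumR vol l <= eps -> outer_measure_le A eps.
Proof.
  intros Hn Hl Hcover Hsum. pose (pt := ((fun _ => 0, fun _ => 0) : box n)).
  exists (fun k => nth k l pt). split; [|split].
  - intros k. destruct (nth_in_or_default k l pt) as [Hin | ->]; [now apply Hl|].
    intros i. apply Rle_refl.
  - intros x Hx. destruct (Hcover x Hx) as [c [Hc Hcx]].
    destruct (In_nth _ _ pt Hc) as [k [_ <-]]. now exists k.
  - intros m. apply Rle_trans with (2 := Hsum). apply sumR_nth_le.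
    + now apply vol_point.
    + intros c Hc. now apply vol_nonneg, Hl.
Qed.

Lemma lebesgue_null_empty {n} : (0 < n)%nat -> lebesgue_null (fun _ : Rn n => False).
Proof.
  intros Hn. apply lebesgue_null_iff_outer_measure_le. intros eps Heps.
  apply outer_measure_le_list with nil; [exact Hn | now intros c [] | now intros x [] |].
  unfold sumR. simpl. lra.
Qed.

(* Every null set lies in a null set of this form, and there are only continuum
   many of these. *)
Definition cover_inter {n} (c : nat -> nat -> box n) (x : Rn n) : Prop :=
  forall j, exists k, mem_box (c j k) x.

Lemma lebesgue_null_in_cover_inter {n} (A : Rn n -> Prop) : lebesgue_null A ->
  exists c, lebesgue_null (cover_inter c) /\ forall x, A x -> cover_inter c x.
Proof.
  intros HA.
  destruct (choice (fun j => box_cover A (/ INR (S j)))) as [c Hc].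
  { intros j. apply (proj1 (lebesgue_null_iff_outer_measure_le A) HA).
    apply Rinv_0_lt_compat, lt_0_INR. lia. }
  exists c. split.
  - apply lebesgue_null_of_outer_measure_le_inv. intros j. exists (c j).
    destruct (Hc j) as [Hproper [_ Hsum]]. split; [exact Hproper | split; [|exact Hsum]].
    intros x Hx. apply Hx.
  - intros x Ax j. now apply (Hc j).
Qed.

Lemma fine_interval_partition d a b : 0 < d -> a <= b -> exists l : list (R * R),
  sumR (fun J => snd J - fst J) l = b - a /\
  (forall t, a <= t <= b -> exists J, In J l /\ fst J <= t <= snd J) /\
  (forall J, In J l -> fst J <= snd J < fst J + d).
Proof.
  intros Hd Hab. destruct (INR_unbounded ((b - a) / (d / 2))) as [k Hk].
  apply Rgt_lt, Rlt_div_l in Hk; [|lra].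
  assert (Hlen : b - a < d + INR k * (d / 2)) by lra. clear Hk.
  revert a Hab Hlen. induction k as [|k IH]; intros a Hab Hlen.
  - simpl in Hlen. exists ((a, b) :: nil). split; [unfold sumR; simpl; ring | split].
    + intros t Ht. exists (a, b). split; [now left | exact Ht].
    + intros J [<- | []]. simpl. lra.
  - rewrite S_INR in Hlen. pose (m := Rmin (a + d / 2) b).
    assert (Hm : a <= m <= a + d / 2 /\ m <= b /\ b - m < d + INR k * (d / 2)).
    { pose proof (pos_INR k). unfold m, Rmin. destruct (Rle_dec (a + d / 2) b); nra. }
    destruct (IH m) as [l [Hsum [Hcover Hfine]]]; [lra | lra|].
    exists ((a, m) :: l). split; [|split].
    + rewrite sumR_cons, Hsum. simpl. ring.
    + intros t Ht. destruct (Rle_dec t m) as [Hle | Hgt].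
      * exists (a, m). split; [now left | simpl; lra].
      * destruct (Hcover t) as [J [HJ HtJ]]; [lra|]. exists J. split; [now right | exact HtJ].
    + intros J [<- | HJ]; [simpl; lra | now apply Hfine].
Qed.

Lemma fine_box_partition {n} (c : box n) d : 0 < d -> proper_box c -> exists G : list (box n),
  sumR vol G = vol c /\
  (forall x, mem_box c x -> exists c', In c' G /\ mem_box c' x) /\
  (forall c', In c' G -> forall i, fst c' i <= snd c' i < fst c' i + d).
Proof.
  intros Hd. induction n as [|n IH]; intros Hc.
  - exists (c :: nil). split; [unfold sumR; simpl; ring | split].
    + intros x Hx. exists c. split; [now left | exact Hx].
    + intros c' _ i. now apply Fin.case0.
  - destruct (fine_interval_partition d _ _ Hd (Hc Fin.F1)) as [l [Hlsum [Hlcover Hlfine]]].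
    destruct (IH (vtail (fst c), vtail (snd c))) as [G [HGsum [HGcover HGfine]]].
    { intros i. apply Hc. }
    exists (map (fun p => box_cons (fst p) (snd p)) (list_prod l G)). split; [|split].
    + rewrite sumR_map, sumR_list_prod. cbn [fst snd].
      transitivity (sumR (fun J => sumR vol G * (snd J - fst J)) l).
      * f_equal. extensionality J. now rewrite Rmult_comm, <- sumR_scal.
      * rewrite sumR_scal, Hlsum, HGsum. apply Rmult_comm.
    + intros x Hx. destruct (Hlcover (x Fin.F1) (Hx Fin.F1)) as [J [HJ HxJ]].
      destruct (HGcover (vtail x)) as [c' [Hc' Hxc']]; [intros i; apply Hx|].
      exists (box_cons J c'). split.
      * apply in_map_iff. exists (J, c'). split; [reflexivity | now apply in_prod].
      * intros i. apply (Fin.caseS' i); [exact HxJ | exact Hxc'].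
    + intros c' Hc'. apply in_map_iff in Hc'. destruct Hc' as [[J c''] [<- Hin]].
      apply in_prod_iff in Hin. destruct Hin as [HJ Hc''].
      intros i. apply (Fin.caseS' i); [now apply Hlfine | now apply HGfine].
Qed.

(* The cells meeting [A a] have total volume more than [eps], and meet no other
   set of the family. *)
Lemma length_large_sets_le {T n} (A : T -> Rn n -> Prop) eps (l : list T) (G : list (box n)) :
  (0 < n)%nat -> NoDup l ->
  (forall c, In c G -> proper_box c) ->
  (forall a x, In a l -> A a x -> exists c, In c G /\ mem_box c x) ->
  (forall c a a' x x', In c G -> In a l -> In a' l ->
    mem_box c x -> A a x -> mem_box c x' -> A a' x' -> a = a') ->
  (forall a, In a l -> ~ outer_measure_le (A a) eps) ->
  INR (length l) * eps <= sumR vol G.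
Proof.
  intros Hn Hnd. revert G. induction Hnd as [|a l Ha Hnd IH]; intros G HG Hcover Hsep Hlarge.
  { rewrite Rmult_0_l. apply sumR_nonneg. intros c Hc. now apply vol_nonneg, HG. }
  pose (meets := fun c => boolp.asbool (exists x, mem_box c x /\ A a x)).
  assert (Hhere : eps < sumR vol (filter meets G)).
  { apply Rnot_le_lt. intros Hle. apply (Hlarge a); [now left|].
    apply outer_measure_le_list with (filter meets G); [exact Hn | | | exact Hle].
    - intros c Hc. apply filter_In in Hc. now apply HG.
    - intros x Hx. destruct (Hcover a x) as [c [Hc Hcx]]; [now left | exact Hx|].
      exists c. split; [|exact Hcx]. apply filter_In. split; [exact Hc|].
      apply boolp.asboolT. now exists x. }
  assert (Hrest : INR (length l) * eps <= sumR vol (filter (fun c => negb (meets c)) G)).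
  { apply IH.
    - intros c Hc. apply filter_In in Hc. now apply HG.
    - intros a' x Ha' Hx. destruct (Hcover a' x) as [c [Hc Hcx]]; [now right | exact Hx|].
      exists c. split; [|exact Hcx]. apply filter_In. split; [exact Hc|].
      apply Bool.negb_true_iff, Bool.not_true_iff_false. intros Hm.
      apply boolp.asboolW in Hm. destruct Hm as [x' [Hcx' Hx']]. apply Ha.
      now rewrite (Hsep c a a' x' x Hc (or_introl eq_refl) (or_intror Ha') Hcx' Hx' Hcx Hx).
    - intros c b b' x x' Hc Hb Hb'. apply filter_In in Hc.
      apply Hsep; [apply Hc | now right | now right].
    - intros b Hb. apply Hlarge. now right. }
  rewrite (sumR_filter_split vol meets). simpl length. rewrite S_INR. lra.
Qed.

(** * Non-null level sets *)

Lemma exists_pos_lower_bound {T} (w : T -> R) (l : list T) :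
  exists e, 0 < e /\ forall a, In a l -> 0 < w a -> e <= w a.
Proof.
  induction l as [|a l [e [He Hl]]]; [exists 1; split; [lra | intros a []]|].
  destruct (Rlt_dec 0 (w a)) as [Ha | Ha].
  - exists (Rmin e (w a)). split; [now apply Rmin_pos|].
    intros b [<- | Hb] Hwb; [apply Rmin_r|].
    apply Rle_trans with (1 := Rmin_l _ _). now apply Hl.
  - exists e. split; [exact He|]. intros b [<- | Hb] Hwb; [contradiction | now apply Hl].
Qed.

Lemma exists_list_separation (l : list R) :
  exists e, 0 < e /\ forall y y', In y l -> In y' l -> Rabs (y - y') < e -> y = y'.
Proof.
  destruct (exists_pos_lower_bound (fun p => Rabs (fst p - snd p)) (list_prod l l))
    as [e [He Hl]].
  exists e. split; [exact He|]. intros y y' Hy Hy' Hlt.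
  apply Rminus_diag_uniq, NNPP. intros Hne.
  pose proof (Hl (y, y') (in_prod _ _ _ _ Hy Hy') (Rabs_pos_lt _ Hne)) as Hle. simpl in Hle. lra.
Qed.

Definition level_set {n} (f : Rn n -> R) (y : R) (x : Rn n) : Prop := f x = y.

Definition level_set_in {n} (c : box n) (f : Rn n -> R) (y : R) (x : Rn n) : Prop :=
  mem_box c x /\ level_set f y x.

(* By uniform continuity, a cell of a fine enough partition of [c] meets at most
   one of the level sets. *)
Lemma length_large_levels_le {n} (f : Rn n -> R) (c : box n) eps (l : list R) :
  (0 < n)%nat -> continuous_Rn f -> proper_box c -> NoDup l ->
  (forall y, In y l -> ~ outer_measure_le (level_set_in c f y) eps) ->
  INR (length l) * eps <= vol c.
Proof.
  intros Hn Hf Hc Hnd Hlarge. destruct (exists_list_separation l) as [e [He Hsep]].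
  destruct (continuous_Rn_uniform_on_box f (fst c) (snd c) e Hf He) as [d [Hd Hunif]].
  destruct (fine_box_partition c d Hd Hc) as [G [<- [Hcover Hfine]]].
  apply (length_large_sets_le (level_set_in c f)); [exact Hn | exact Hnd | | | | exact Hlarge].
  - intros c' Hc' i. apply (Hfine c' Hc').
  - intros y x _ [Hx _]. now apply Hcover.
  - intros c' y y' x x' Hc' Hy Hy' Hx [Hcx <-] Hx' [Hcx' <-].
    apply Hsep; [exact Hy | exact Hy'|]. apply Hunif; [exact Hcx'|].
    intros i. specialize (Hfine c' Hc' i). specialize (Hx i). specialize (Hx' i).
    apply Rabs_def1; lra.
Qed.

Lemma exists_list_of_bounded {T : Type} N (P : T -> Prop) :
  (forall l, NoDup l -> (forall x, In x l -> P x) -> (length l <= N)%nat) ->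
  exists l, forall x, P x -> In x l.
Proof.
  revert P. induction N as [|N IH]; intros P Hbound.
  - exists nil. intros x Px. exfalso. enough (1 <= 0)%nat by lia. apply (Hbound (x :: nil)).
    + constructor; [now intros [] | constructor].
    + now intros y [<- | []].
  - destruct (classic (exists x, P x)) as [[x Px] | Hno].
    2:{ exists nil. intros x Px. apply Hno. now exists x. }
    destruct (IH (fun y => P y /\ y <> x)) as [l Hl].
    + intros l Hnd Hl. apply le_S_n, (Hbound (x :: l)).
      * constructor; [|exact Hnd]. intros Hx. now apply (Hl x Hx).
      * intros y [<- | Hy]; [exact Px | now apply Hl].
    + exists (x :: l). intros y Py. destruct (classic (y = x)) as [-> | Hne]; [now left|].
      right. now apply Hl.
Qed.

Lemma countable_large_levels {n} (f : Rn n -> R) (c : box n) eps :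
  (0 < n)%nat -> continuous_Rn f -> proper_box c -> 0 < eps ->
  countable (fun y => ~ outer_measure_le (level_set_in c f y) eps).
Proof.
  intros Hn Hf Hc Heps. destruct (INR_unbounded (vol c / eps)) as [N HN].
  destruct (exists_list_of_bounded N (fun y => ~ outer_measure_le (level_set_in c f y) eps))
    as [l Hl].
  - intros l Hnd Hlarge. apply INR_le, Rlt_le, Rle_lt_trans with (2 := HN).
    apply Rle_div_r; [exact Heps|]. now apply (length_large_levels_le f).
  - exact (countable_of_list _ l Hl).
Qed.

Definition cube (n M : nat) : box n := (fun _ => - INR M, fun _ => INR M).

Lemma proper_cube n M : proper_box (cube n M).
Proof. intros i. simpl. pose proof (pos_INR M). lra. Qed.

Lemma exists_mem_cube {n} (x : Rn n) : exists M, mem_box (cube n M) x.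
Proof.
  induction n as [|n IH].
  - exists 0%nat. intros i. now apply Fin.case0.
  - destruct (IH (vtail x)) as [M HM].
    destruct (INR_unbounded (Rabs (x Fin.F1))) as [m Hm].
    exists (M + m)%nat. intros i. simpl. rewrite plus_INR.
    pose proof (pos_INR M). pose proof (pos_INR m). apply (Fin.caseS' i).
    + apply Rgt_lt, Rabs_def2 in Hm. lra.
    + intros j. specialize (HM j). unfold vtail in HM. simpl in HM. lra.
Qed.

Lemma countable_non_null_levels {n} (f : Rn n -> R) : (0 < n)%nat -> continuous_Rn f ->
  countable (fun y => ~ lebesgue_null (level_set f y)).
Proof.
  intros Hn Hf.
  apply countable_subset with (fun y => exists M, exists j,
    ~ outer_measure_le (level_set_in (cube n M) f y) (/ INR (S j))).
  - intros y Hy. apply NNPP. intros Hsmall. apply Hy.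
    apply lebesgue_null_subset with (fun x => exists M, level_set_in (cube n M) f y x).
    + intros x Hx. destruct (exists_mem_cube x) as [M HM]. now exists M.
    + apply lebesgue_null_bigcup. intros M. apply lebesgue_null_of_outer_measure_le_inv. intros j.
      apply NNPP. intros Hlarge. apply Hsmall. now exists M, j.
  - apply countable_bigcup. intros M. apply countable_bigcup. intros j.
    apply countable_large_levels; [exact Hn | exact Hf | apply proper_cube|].
    apply Rinv_0_lt_compat, lt_0_INR. lia.
Qed.

Lemma closed_set_level_set {n} (f : Rn n -> R) y :
  continuous_Rn f -> Defs.closed_set (level_set f y).
Proof.
  intros Hf x Hx. assert (He : 0 < Rabs (f x - y)) by now apply Rabs_pos_lt, Rminus_eq_contra.
  destruct (Hf x _ He) as [d [Hd Hnear]]. exists d. split; [exact Hd|].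
  intros z Hz E. specialize (Hnear z Hz). rewrite E, Rabs_minus_sym in Hnear. lra.
Qed.

(** * The construction *)

Lemma exists_point_avoiding_levels {n T} (f : T -> Rn n -> R) (y : T -> R)
    (P : T -> Prop) (N : Rn n -> Prop) :
  star_hyp n -> le_continuum T -> lt_continuum P -> lebesgue_null N ->
  (forall b, P b -> continuous_Rn (f b) /\ lebesgue_null (level_set (f b) (y b))) ->
  exists x, ~ N x /\ forall b, P b -> f b x <> y b.
Proof.
  intros Hstar HT HP HN Hf.
  destruct (Hstar (fun A => exists b, P b /\ A = level_set (f b) (y b)) N) as [x [HxN Hx]].
  - intros A [b [Hb ->]]. destruct (Hf b Hb) as [Hcont Hnull].
    split; [now apply closed_set_level_set | exact Hnull].
  - now apply card_lt_continuum_image.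
  - exact HN.
  - exists x. split; [exact HxN|]. intros b Hb. apply (Hx (level_set (f b) (y b))). now exists b.
Qed.

Lemma exists_null_level_avoiding {n} (f : Rn n -> R) p q (Z : R -> Prop) :
  (0 < n)%nat -> continuous_Rn f -> p < q -> lt_continuum Z ->
  exists y, (p <= y <= q /\ lebesgue_null (level_set f y)) /\ ~ Z y.
Proof.
  intros Hn Hf Hpq HZ. apply NNPP. intros Hno. apply (not_lt_continuum_interval p q Hpq).
  intros [h [Hh Hin]].
  apply (lt_continuum_union _ _ HZ (lt_continuum_countable _ (countable_non_null_levels f Hn Hf))).
  exists h. split; [exact Hh|]. intros t. apply NNPP. intros Hbad. apply Hno. exists (h t).
  specialize (Hin t). tauto.
Qed.

(* A requirement on the set to be constructed: it is not contained in
   [cover_inter cover], and [fn] omits on it some value between [lo] and [hi]. *)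
Record task (n : nat) : Type := Task {
  fn : Rn n -> R; fn_continuous : continuous_Rn fn;
  lo : R; hi : R; lo_lt_hi : lo < hi;
  cover : nat -> nat -> box n; cover_null : lebesgue_null (cover_inter cover) }.

Arguments fn {n}. Arguments fn_continuous {n}. Arguments lo {n}. Arguments hi {n}.
Arguments lo_lt_hi {n}. Arguments cover {n}. Arguments cover_null {n}.

Lemma le_continuum_task n : le_continuum (task n).
Proof.
  apply (le_continuum_inj (fun a =>
    (exist (@continuous_Rn n) (fn a) (fn_continuous a), (lo a, hi a), cover a))).
  - intros [f Hf p q Hpq c Hc] [f' Hf' p' q' Hpq' c' Hc'] E. cbn in E.
    injection E as Ef Ep Eq Ec. subst. f_equal; apply proof_irrelevance.
  - repeat apply le_continuum_prod; try exact le_continuum_R.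
    + apply le_continuum_continuous.
    + apply le_continuum_seq, le_continuum_seq, le_continuum_prod; apply le_continuum_Rn.
Qed.

Lemma exists_task {n} (f : Rn n -> R) p q (A : Rn n -> Prop) :
  continuous_Rn f -> p < q -> lebesgue_null A ->
  exists a, fn a = f /\ lo a = p /\ hi a = q /\ forall x, A x -> cover_inter (cover a) x.
Proof.
  intros Hf Hpq HA. destruct (lebesgue_null_in_cover_inter A HA) as [c [Hc HAc]].
  now exists (Task n f Hf p q Hpq c Hc).
Qed.

Lemma exists_points_meeting_tasks n : (0 < n)%nat -> star_hyp n ->
  exists (x : task n -> Rn n) (y : task n -> R), forall a,
    ~ cover_inter (cover a) (x a) /\ lo a <= y a <= hi a /\ forall b, fn a (x b) <> y a.
Proof.
  intros Hn Hstar.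
  destruct (exists_continuum_well_order _ (le_continuum_task n)) as [lt [Hwf [Htri Hseg]]].
  destruct (transfinite_avoidance lt fn (fun a => cover_inter (cover a))
    (fun a y => lo a <= y <= hi a /\ lebesgue_null (level_set (fn a) y))) as [x [y Hxy]].
  - exact Hwf.
  - exact Htri.
  - exact (inhabits (fun _ => 0)).
  - exact (inhabits 0).
  - intros a y Hy. apply exists_point_avoiding_levels.
    + exact Hstar.
    + apply le_continuum_task.
    + apply Hseg.
    + apply cover_null.
    + intros b Hb. split; [apply fn_continuous | now apply Hy].
  - intros a x xa.
    destruct (exists_null_level_avoiding (fn a) (lo a) (hi a)
      (fun y => y = fn a xa \/ exists b, lt b a /\ y = fn a (x b))) as [y [Hy Havoid]].
    + exact Hn.
    + apply fn_continuous.
    + apply lo_lt_hi.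
    + apply lt_continuum_union; [|apply lt_continuum_image, Hseg].
      apply lt_continuum_countable, countable_of_list with (fn a xa :: nil).
      intros y ->. now left.
    + exists y. split; [exact Hy | split].
      * intros E. apply Havoid. now left.
      * intros b Hb E. apply Havoid. right. now exists b.
  - exists x, y. intros a. specialize (Hxy a). tauto.
Qed.

Theorem theorem3p4 (n : nat) (hn : (0 < n)%nat) (hstar : star_hyp n) :
  exists A : Rn n -> Prop,
    ~ lebesgue_null A /\
    forall f : Rn n -> R, continuous_Rn f -> ~ image_contains_interval f A.
Proof.
  destruct (exists_points_meeting_tasks n hn hstar) as [x [y Hxy]].
  exists (fun z => exists a, z = x a). split.
  - intros HA.
    destruct (exists_task (fun _ => 0) 0 1 _ (continuous_Rn_const n 0) Rlt_0_1 HA)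
      as [a [_ [_ [_ Ha]]]].
    destruct (Hxy a) as [Hnot _]. apply Hnot, Ha. now exists a.
  - intros f Hf [p [q [Hpq Himage]]].
    destruct (exists_task f p q _ Hf Hpq (lebesgue_null_empty hn)) as [a [<- [<- [<- _]]]].
    destruct (Hxy a) as [_ [Hy Hmiss]]. destruct (Himage _ Hy) as [z [[b ->] E]].
    exact (Hmiss b E).
Qed.
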